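(* Let $(X,\cdot)$ be a group and let $\mathbb{C}$ be a stratified $L$-convex structure on $X$. Then $(X,\cdot,\mathbb{C})$ is a stratified $L$-convex group if and only if the following holds: for all $x,y\in X$, $a\in J(L)$ and $A\in R^{\mathbb{C}}_{(xy^{-1})_a}$, there exist $B,C\in\mathbb{C}$ with $B\in R^{\mathbb{C}}_{x_a}$ or $C\in R^{\mathbb{C}}_{y_a}$ such that $$\big(B'\odot\hat{\top}^{-1}\big)\vee\big(\hat{\top}\odot (C')^{-1}\big)\le A'.$$
   Context: Throughout, $L=(L,\le,\top,\bot,\wedge,\vee,{}')$ is a completely distributive De Morgan algebra (a completely distributive complete lattice with greatest element $\top$, least element $\bot$, and an order-reversing involution $'$). $J(L)$ is the set of nonzero coprime elements: $a\in J(L)$ iff $a\ne\bot$ and $a\le b\vee c$ implies $a\le b$ or $a\le c$. $L^X$ is the set of maps $X\to L$, with pointwise order and operations $\vee,\wedge,{}'$; $\hat a\in L^X$ is the constant map with value $a\in L$. For $x\in X$, $a\in J(L)$, $x_a\in L^X$ takes value $a$ at $x$ and $\bot$ elsewhere. A stratified $L$-convex structure on $X$ is a family $\mathbb{C}\subseteq L^X$ such that $\hat a\in\mathbb{C}$ for all $a\in L$, $\mathbb{C}$ is closed under arbitrary pointwise infima, and $\mathbb{C}$ is closed under pointwise suprema of directed subfamilies; $(X,\mathbb{C})$ is then a stratified $L$-convex space. A map $f:(X,\mathbb{C})\to(Y,\mathbb{G})$ is an LCP ($L$-convexity-preserving map) if $f^{\leftarrow}(A)=A\circ f\in\mathbb{C}$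 for all $A\in\mathbb{G}$. For $A,B\in L^X$, $A\times B\in L^{X\times X}$ is $(x_1,x_2)\mapsto A(x_1)\wedge B(x_2)$. The product structure $\mathbb{C}\times\mathbb{C}$ on $X\times X$ is the initial (smallest) stratified $L$-convex structure making both projections LCPs; it equals $\{C_1\times C_2\mid C_1,C_2\in\mathbb{C}\}$. A stratified $L$-convex group $(X,\cdot,\mathbb{C})$ is a group $(X,\cdot)$ with a stratified $L$-convex structure $\mathbb{C}$ on $X$ such that multiplication $(X\times X,\mathbb{C}\times\mathbb{C})\to(X,\mathbb{C})$ and inversion $(X,\mathbb{C})\to(X,\mathbb{C})$ are LCPs. For $A,B\in L^X$, $A^{-1}(u)=A(u^{-1})$ and $(A\odot B)(u)=\bigvee_{xy=u}\big(A(x)\wedge B(y)\big)$. The $L$-convex remote-neighborhood system at $x_a$ is $R^{\mathbb{C}}_{x_a}=\{A\in L^X\mid \exists C\in\mathbb{C}\text{ with }x_a\le C'\le A'\}$. *)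

(* Defs.v *)
From HB Require Import structures.
From mathcomp Require Import all_boot all_order.
From mathcomp Require Import boolp classical_sets functions.

Set Implicit Arguments.
Unset Strict Implicit.
Unset Printing Implicit Defensive.

Import Order.TTheory.

Local Open Scope classical_set_scope.

Section Bounds.
Context {d : Order.disp_t} {L : tbLatticeType d}.
Implicit Types S : set L.

(* The default values of [supremum] and [infimum] are those of the empty set. *)
Definition Sup S : L := supremum \bot%O S.
Definition Inf S : L := infimum \top%O S.

End Bounds.

(* Existence of all suprema suffices for completeness; see [InfP]. *)
HB.mixin Record isCompletelyDistributive d (L : Type) of Order.TBLattice d L := {
  supremums_neq0 : forall S : set L, supremums S !=set0;
  Inf_Sup_distr : forall (I : Type) (J : I -> Type) (F : forall i, J i -> L),
    Inf (range (fun i => Sup (range (F i)))) =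
    Sup (range (fun h : (forall i, J i) => Inf (range (fun i => F i (h i)))))
}.

#[short(type="cdLatticeType")]
HB.structure Definition CDLattice d :=
  { L of isCompletelyDistributive d L & Order.TBLattice d L }.

HB.mixin Record hasDeMorganInvolution d (L : Type) of Order.TBLattice d L := {
  neg : L -> L;
  negK : involutive neg;
  le_neg : forall a b : L, (a <= b)%O -> (neg b <= neg a)%O
}.

#[short(type="cdDeMorganType")]
HB.structure Definition CDDeMorgan d :=
  { L of hasDeMorganInvolution d L & CDLattice d L }.

Section CompleteLattice.
Context {d : Order.disp_t} {L : cdLatticeType d}.
Implicit Types (S : set L) (a b c : L).

Lemma SupP S : supremums S (Sup S).
Proof.
rewrite /Sup /supremum; case: ifPn => [/eqP ->|_].
  by split=> [x []|x _]; exact: le0x.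
by have [m Sm] := supremums_neq0 S; case: xgetP => [x _ //|/(_ m)].
Qed.

Lemma InfP S : infimums S (Inf S).
Proof.
rewrite /Inf /infimum; case: ifPn => [/eqP ->|_].
  by split=> [x []|x _]; exact: lex1.
have [m [m1 m2]] := supremums_neq0 (lbound S).
have Sm : infimums S m by split=> // x Sx; apply: m2 => y; apply.
by case: xgetP => [x _ //|/(_ m)].
Qed.

Definition coprime_element a : Prop :=
  a != \bot%O /\
  forall b c, (a <= b `|` c)%O -> (a <= b)%O \/ (a <= c)%O.

End CompleteLattice.

(* Functions [X -> L] carry the pointwise order and lattice operations. *)
Section ConvexSpaces.
Context {d : Order.disp_t} {L : cdDeMorganType d}.

Definition negf {X : Type} (A : X -> L) : X -> L := fun x => neg (A x).

Definition Supf {X : Type} (F : set (X -> L)) : X -> L :=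
  fun x => Sup [set A x | A in F].

Definition Inff {X : Type} (F : set (X -> L)) : X -> L :=
  fun x => Inf [set A x | A in F].

Definition directed {X : Type} (F : set (X -> L)) : Prop :=
  F !=set0 /\
  forall A B, F A -> F B -> exists D, [/\ F D, (A <= D)%O & (B <= D)%O].

Record stratified_convex {X : Type} (C : set (X -> L)) : Prop :=
  StratifiedConvex {
    convex_cst : forall a : L, C (cst a);
    convex_Inf : forall F, F `<=` C -> C (Inff F);
    convex_directed_Sup : forall F, F `<=` C -> directed F -> C (Supf F)
  }.

Definition lcp {X Y : Type} (C : set (X -> L)) (G : set (Y -> L))
    (f : X -> Y) : Prop :=
  forall A, G A -> C (A \o f).

Definition prod_convex {X Y : Type} (C : set (X -> L)) (G : set (Y -> L)) :
    set (X * Y -> L) :=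
  \bigcap_(E in [set E | [/\ stratified_convex E, lcp E C fst & lcp E G snd]]) E.

Lemma prod_convex_stratified {X Y : Type} (C : set (X -> L))
    (G : set (Y -> L)) : stratified_convex (prod_convex C G).
Proof.
split=> [a E [EC _ _]|F FC E EP|F FC Fd E EP]; first exact: convex_cst.
  by have [EC _ _] := EP; apply: convex_Inf => // A /FC; apply.
by have [EC _ _] := EP; apply: convex_directed_Sup => // A /FC; apply.
Qed.

Lemma prod_convex_fst {X Y : Type} (C : set (X -> L)) (G : set (Y -> L)) :
  lcp (prod_convex C G) C fst.
Proof. by move=> A CA E [_ + _]; apply. Qed.

Lemma prod_convex_snd {X Y : Type} (C : set (X -> L)) (G : set (Y -> L)) :
  lcp (prod_convex C G) G snd.
Proof. by move=> A GA E [_ _]; apply. Qed.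

Definition fuzzy_point {X : eqType} (x : X) (a : L) : X -> L :=
  fun y => if y == x then a else \bot%O.

Definition remote_nbhd {X : eqType} (C : set (X -> L)) (x : X) (a : L) :
    set (X -> L) :=
  [set A | exists D, [/\ C D, (fuzzy_point x a <= negf D)%O
                            & (negf D <= negf A)%O]].

End ConvexSpaces.

Section ConvexGroups.
Context {d : Order.disp_t} {L : cdDeMorganType d} {X : groupType}.
Implicit Types (A B : X -> L) (C : set (X -> L)).

Definition stratified_convex_group C : Prop :=
  [/\ stratified_convex C,
      lcp (prod_convex C C) C (fun p : X * X => (p.1 * p.2)%g) &
      lcp C C (fun x : X => (x^-1)%g)].

Definition invf A : X -> L := fun u => A (u^-1)%g.

Definition odot A B : X -> L := fun u =>
  Sup [set (A p.1 `&` B p.2)%O | p in [set p : X * X | (p.1 * p.2)%g = u]].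

End ConvexGroups.

(* Main.v *)
Require Import Defs.
From HB Require Import structures.
From mathcomp Require Import all_boot all_order.
From mathcomp Require Import boolp classical_sets functions.

(** Both sides of the equivalence say that every member of [C] is a constant
map.

The members of the product structure [prod_convex C C] are rectangular: they
satisfy [E (x, y) `&` E (x', y') <= E (x, y')].  Indeed rectangular maps form a
stratified convex structure (directed suprema are handled by the frame law
[meet_Sup_le]) making both projections convexity preserving, so the product
structure, being the smallest such, consists of rectangular maps
([prod_convex_rectangular]).  If multiplication is convexity preserving, then
[A (x * y)] is rectangular in [(x, y)] for every [A] in [C]; solving
[x * y = x' * y' = z] and [x * y' = w] in the group gives [A z <= A w] for all
[z] and [w].

On the other side, [odot (negf B) (invf (cst \top))] is the constant map whose
value is the supremum of [negf B], and [odot (cst \top) (invf (negf D))] is the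
constant map whose value is the supremum of [negf D].  Hence for [A] in [C] the
condition says that a coprime element lying below one value of [negf A] lies
below all of them.  Coprime elements separate the points of a completely
distributive De Morgan algebra ([coprime_separation]), so [negf A] is constant.

The separation theorem is obtained from prime elements by negation.  In a
completely distributive lattice each [x] is the supremum of the elements
totally below it ([le_Sup_totally_below]); when [a] is not below [c] this
gives a sequence starting at [a], each term totally below the previous one and
none below [c].  The up-closure of that sequence is a Scott open filter, and an
element that is maximal above [c] outside this filter is prime. *)

Set Implicit Arguments.
Unset Strict Implicit.
Unset Printing Implicit Defensive.

Import Order.TTheory.

Local Open Scope classical_set_scope.

(** * Completely distributive lattices *)

Section CompletelyDistributive.
Context {d : Order.disp_t} {L : cdLatticeType d}.
Implicit Types (S : set L) (a b c m x y z : L).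

Lemma le_Sup S x : S x -> (x <= Sup S)%O.
Proof. by case: (SupP S) => + _; apply. Qed.

Lemma Sup_le S m : (forall x, S x -> (x <= m)%O) -> (Sup S <= m)%O.
Proof. by case: (SupP S) => _; apply. Qed.

Lemma Inf_le S x : S x -> (Inf S <= x)%O.
Proof. by case: (InfP S) => + _; apply. Qed.

Lemma le_Inf S m : (forall x, S x -> (m <= x)%O) -> (m <= Inf S)%O.
Proof. by case: (InfP S) => _; apply. Qed.

(** The frame law, as an induction principle for upper bounds. *)
Lemma meet_Sup_le a S m :
  (forall x, S x -> (a `&` x <= m)%O) -> (a `&` Sup S <= m)%O.
Proof.
move=> Sm.
(* The meet is the infimum of two suprema, over [unit] and over [S]. *)
pose J (b : bool) := if b return Type then unit else {x | S x}.
pose F (b : bool) : J b -> L :=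
  match b return J b -> L with true => fun=> a | false => @sval _ _ end.
have aS : (a `&` Sup S <= Inf (range (fun i => Sup (range (F i)))))%O.
  apply: le_Inf => _ [[] _ <-].
    by rewrite leIxl//; apply: le_Sup; exists tt.
  rewrite leIxr//; apply: Sup_le => x Sx.
  by apply: le_Sup; exists (exist _ x Sx).
apply: (le_trans aS); rewrite Inf_Sup_distr.
apply: Sup_le => _ [h _ <-]; apply: le_trans (Sm _ (svalP (h false))).
by rewrite lexI; apply/andP; split; apply: Inf_le; [exists true|exists false].
Qed.

Lemma Sup_meet_le a S m :
  (forall x, S x -> (x `&` a <= m)%O) -> (Sup S `&` a <= m)%O.
Proof. by move=> Sm; rewrite meetC; apply: meet_Sup_le => x /Sm; rewrite meetC. Qed.

Lemma meet_join_le a b c m :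
  (a `&` b <= m)%O -> (a `&` c <= m)%O -> (a `&` (b `|` c) <= m)%O.
Proof.
move=> abm acm; have bc : (b `|` c <= Sup [set b; c])%O.
  by rewrite leUx; apply/andP; split; apply: le_Sup; [left|right].
apply: le_trans (leI2 (lexx a) bc) _.
by apply: meet_Sup_le => x [] ->.
Qed.

(** Raney's relation: every family whose supremum is above [y] has a member
above [x]; the family need not be directed. *)
Definition totally_below x y : Prop :=
  forall S, (y <= Sup S)%O -> exists2 s, S s & (x <= s)%O.

Lemma le_Sup_totally_below y : (y <= Sup [set x | totally_below x y])%O.
Proof.
pose I := {S | (y <= Sup S)%O}.
pose J (i : I) : Type := {x | sval i x}.
pose F (i : I) (j : J i) : L := sval j.
have yF : (y <= Inf (range (fun i => Sup (range (@F i)))))%O.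
  apply: le_Inf => _ [i _ <-]; apply: le_trans (svalP i) _.
  by apply: Sup_le => x ix; apply: le_Sup; exists (exist _ x ix).
(* The infimum of a choice of members of all the families with supremum above
   [y] is totally below [y]. *)
apply: (le_trans yF); rewrite Inf_Sup_distr; apply: Sup_le => _ [h _ <-].
apply: le_Sup => S yS; pose i : I := exist _ S yS.
by exists (F i (h i)); [exact: (svalP (h i))|apply: Inf_le; exists i].
Qed.

(** The order dual of [coprime_element]. *)
Definition prime_element q : Prop :=
  q != \top%O /\
  forall b c, (b `&` c <= q)%O -> (b <= q)%O \/ (c <= q)%O.

Lemma prime_separation a c : ~~ (a <= c)%O ->
  exists q, [/\ prime_element q, (c <= q)%O & ~~ (a <= q)%O].
Proof.
move=> nac.
have /choice[f fP] x :
    exists y, ~~ (x <= c)%O -> totally_below y x /\ ~~ (y <= c)%O.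
  have [xc|nxc] := boolP (x <= c)%O; first by exists x.
  apply: contrapT => nex; case/negP: nxc.
  apply: le_trans (le_Sup_totally_below x) _; apply: Sup_le => y yx.
  by apply: contrapT => /negP nyc; apply: nex; exists y.
pose u n := iter n f a.
have uc n : ~~ (u n <= c)%O by elim: n => //= n /fP[].
have ub n : totally_below (u n.+1) (u n) by have [] := fP _ (uc n).
have uS n : (u n.+1 <= u n)%O.
  have [|s -> //] := ub n [set u n]; exact: le_Sup.
have u_dec (i n : nat) : (i <= n)%N -> (u n <= u i)%O.
  elim: n => [|n IHn]; first by rewrite leqn0 => /eqP ->.
  rewrite leq_eqVlt => /predU1P[-> //|/IHn]; exact/le_trans/uS.
(* [F] is a filter since [u] decreases, and it is inaccessible by suprema since
   each [u n.+1] is totally below [u n]. *)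
pose F := [set z | exists n, (u n <= z)%O].
pose T := {z | (c <= z)%O /\ ~ F z}.
have Fc : ~ F c by case=> n; exact/negP.
pose t0 : T := exist _ c (conj (lexx c) Fc).
pose R : rel T := fun s t => (sval s <= sval t)%O.
have [|||q qmax] := @ZL_preorder T t0 R.
- by move=> t; exact: lexx.
- by move=> r s t; exact: le_trans.
- move=> D _; pose z := Sup (c |` [set sval t | t in D]).
  have cz : (c <= z)%O by apply: le_Sup; left.
  have Fz : ~ F z.
    (* A member of the family would be above [u n.+1], hence in [F]. *)
    case=> n /ub[s [->|[t _ <-]] us]; first by apply: (Fc); exists n.+1.
    by case: (svalP t) => _; apply; exists n.+1.
  exists (exist _ z (conj cz Fz)) => s Ds.
  by apply: le_Sup; right; exists s.
have [cq nFq] := svalP q.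
have FU b : ~~ (b <= sval q)%O -> F (sval q `|` b)%O.
  move=> nbq; apply: contrapT => nF.
  have cqb : (c <= sval q `|` b)%O by rewrite lexUl.
  have := qmax (exist _ _ (conj cqb nF)); rewrite /R/= leUl => /(_ isT).
  by rewrite leUx (negPf nbq) andbF.
exists (sval q); split => //; last by apply/negP => aq; apply: nFq; exists 0%N.
split=> [|b e beq].
  by apply/eqP => qT; apply: nFq; exists 0%N; rewrite qT lex1.
have [bq|/FU[m um]] := boolP (b <= sval q)%O; first by left.
have [eq|/FU[n un]] := boolP (e <= sval q)%O; first by right.
(* Otherwise [F] contains both joins, hence their meet, hence [sval q]. *)
case: nFq; exists (maxn m n).
have le1 : (u (maxn m n) <= sval q `|` b)%O.
  exact: le_trans (u_dec _ _ (leq_maxl m n)) um.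
have le2 : (u (maxn m n) <= sval q `|` e)%O.
  exact: le_trans (u_dec _ _ (leq_maxr m n)) un.
have : (u (maxn m n) <= (sval q `|` b) `&` (sval q `|` e))%O.
  by rewrite lexI le1.
move/le_trans; apply; apply: meet_join_le; first exact: leIr.
rewrite meetC; apply: meet_join_le; first exact: leIr.
by rewrite meetC.
Qed.

End CompletelyDistributive.

Section DeMorgan.
Context {d : Order.disp_t} {L : cdDeMorganType d}.
Implicit Types (a b c q x y : L).

Lemma le_negE x y : (neg x <= neg y)%O = (y <= x)%O.
Proof.
apply/idP/idP; last exact: le_neg.
by move/le_neg; rewrite !negK.
Qed.

Lemma neg_le x y : (neg x <= y)%O = (neg y <= x)%O.
Proof. by rewrite -{1}[y]negK le_negE. Qed.

Lemma coprime_neg q : prime_element q -> coprime_element (neg q).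
Proof.
case=> q1 qP; split=> [|b c qbc].
  apply: contraNneq q1 => q0; rewrite -le1x -le_negE q0; exact: le0x.
have : (neg b `&` neg c <= q)%O.
  rewrite -le_negE; apply: (le_trans qbc); rewrite leUx -{1}[b]negK.
  by rewrite le_negE leIl -{1}[c]negK le_negE leIr.
by case/qP; rewrite neg_le; [left|right].
Qed.

Lemma coprime_separation a c : ~~ (a <= c)%O ->
  exists p, [/\ coprime_element p, (p <= a)%O & ~~ (p <= c)%O].
Proof.
rewrite -le_negE => /prime_separation[q [/coprime_neg qP aq cq]].
by exists (neg q); rewrite neg_le aq neg_le.
Qed.

End DeMorgan.

(** * Rectangular maps on a product *)

Section Rectangular.
Context {d : Order.disp_t} {L : cdDeMorganType d} {X Y : Type}.

(** On a complete lattice satisfying the frame law these are exactly the maps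
of the form [(x, y) |-> A x `&` B y]; only rectangularity is needed. *)
Definition rectangular (E : X * Y -> L) : Prop :=
  forall x y x' y', (E (x, y) `&` E (x', y') <= E (x, y'))%O.

Lemma rectangular_convex : stratified_convex [set E | rectangular E].
Proof.
split=> [a x y x' y'|F FP x y x' y'|F FP [_ Fd] x y x' y'].
- exact: leIl.
- apply: le_Inf => _ [E FE <-]; apply: le_trans (FP _ FE x y x' y').
  by apply: leI2; apply: Inf_le; exists E.
- apply: Sup_meet_le => _ [E1 FE1 <-]; apply: meet_Sup_le => _ [E2 FE2 <-].
  have [E [FE /lefP E1E /lefP E2E]] := Fd _ _ FE1 FE2.
  apply: le_trans (leI2 (E1E _) (E2E _)) _.
  by apply: le_trans (FP _ FE _ _ _ _) _; apply: le_Sup; exists E.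
Qed.

Lemma prod_convex_rectangular (C : set (X -> L)) (G : set (Y -> L)) :
  prod_convex C G `<=` [set E | rectangular E].
Proof.
move=> E; apply; split; first exact: rectangular_convex.
  by move=> A _ x y x' y'; exact: leIl.
by move=> A _ x y x' y'; exact: leIr.
Qed.

End Rectangular.

(** * Convex structures on groups *)

Section Groups.
Context {d : Order.disp_t} {L : cdDeMorganType d} {X : groupType}.
Implicit Types (A B : X -> L) (C : set (X -> L)).

Lemma fuzzy_point_le (x : X) (a : L) A :
  (fuzzy_point x a <= A)%O = (a <= A x)%O.
Proof.
apply/lefP/idP => [/(_ x)|aA y]; rewrite /fuzzy_point ?eqxx//.
by case: eqP => [->|_] //; exact: le0x.
Qed.

Lemma odotTr A : odot A (invf (cst \top%O)) = cst (Sup (range A)).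
Proof.
apply/funext => u; apply/le_anti/andP; split; apply: Sup_le.
  by move=> _ [[x y] _ <-] /=; rewrite leIxl//; apply: le_Sup; exists x.
move=> _ [x _ <-]; apply: le_Sup; exists (x, (x^-1 * u)%g) => /=.
  by rewrite mulgA mulgV mul1g.
by rewrite /invf meetx1.
Qed.

Lemma odotTl A : odot (cst \top%O) (invf A) = cst (Sup (range A)).
Proof.
apply/funext => u; apply/le_anti/andP; split; apply: Sup_le.
  by move=> _ [[x y] _ <-] /=; rewrite leIxr//; apply: le_Sup; exists (y^-1)%g.
move=> _ [x _ <-]; apply: le_Sup; exists ((u * x)%g, (x^-1)%g) => /=.
  by rewrite -mulgA mulgV mulg1.
by rewrite /invf invgK meet1x.
Qed.

Lemma convex_group_constant C A :
  stratified_convex_group C -> C A -> forall z w, (A z <= A w)%O.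
Proof.
case=> _ Cmul _ CA z w.
have /prod_convex_rectangular := Cmul _ CA.
move/(_ 1%g z (z * w^-1)%g w) => /=.
by rewrite !mul1g -mulgA mulVg mulg1 meetxx.
Qed.

Lemma constant_convex_group C : stratified_convex C ->
  (forall A, C A -> forall z w, (A z <= A w)%O) -> stratified_convex_group C.
Proof.
move=> hC Ccst; have CE A : C A -> A = cst (A 1%g).
  by move=> /Ccst CA; apply/funext => x; apply/le_anti; rewrite !CA.
split=> // A /CE ->; last exact: (convex_cst hC).
exact: (convex_cst (prod_convex_stratified C C)).
Qed.

End Groups.

Theorem theorem4p11 (d : Order.disp_t) (L : cdDeMorganType d) (X : groupType)
    (C : set (X -> L)) (hC : stratified_convex C) :
  stratified_convex_group C <->
  forall (x y : X) (a : L) (A : X -> L),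
    coprime_element a -> remote_nbhd C (x * y^-1)%g a A ->
    exists B D : X -> L,
      [/\ C B, C D, remote_nbhd C x a B \/ remote_nbhd C y a D &
          (odot (negf B) (invf (cst \top)) `|` odot (cst \top) (invf (negf D))
             <= negf A)%O].
Proof.
split=> [Cg x y a A _ [E [CE]]|H].
  rewrite fuzzy_point_le => aE /lefP EA.
  (* [E] is constant, so any of its values yields suitable [B] and [D]. *)
  pose e := E (x * y^-1)%g; exists (cst e), (cst e).
  have Ce : C (cst e) by exact: convex_cst.
  split=> //; first by left; exists (cst e); rewrite fuzzy_point_le lexx.
  have eA z : (Sup (range (@negf _ L X (cst e))) <= negf A z)%O.
    apply: Sup_le => _ [w _ <-]; apply: le_trans (EA z).
    exact/le_neg/(convex_group_constant Cg CE).
  by rewrite odotTr odotTl leUx; apply/andP; split; apply/lefP.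
apply: constant_convex_group => // A CA z w; rewrite -le_negE.
(* A coprime [p] below [negf A w] is moved to [negf A z] by the hypothesis at the
   points [w] and [1], whichever of [B] and [D] is the remote neighborhood. *)
apply/negPn/negP => /coprime_separation[p [pP pw /negP]]; apply.
have [] := H w 1%g p A pP.
  by exists A; rewrite fuzzy_point_le invg1 mulg1 lexx.
move=> B [D [CB CD BD]]; rewrite odotTr odotTl leUx => /andP[/lefP BA /lefP DA].
case: BD => -[E [_ + /lefP E_le]]; rewrite fuzzy_point_le => pE.
  apply: le_trans (BA z); apply: le_trans pE (le_trans (E_le _) _).
  by apply: le_Sup; exists w.
apply: le_trans (DA z); apply: le_trans pE (le_trans (E_le _) _).
by apply: le_Sup; exists 1%g.
Qed.
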